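(* Let $\Bbbk$ be an algebraically closed field of characteristic $0$ and let $G$ be an elementary $2$-group of rank $n>2$, with the trivial action of $C_2$. The short exact sequence of $\mathrm{Aut}(G)$-modules $$\widehat G\rightarrowtail \mathbb{X}(\mathrm{triv})\twoheadrightarrow\mathrm{Alt}(G)$$ does not split (as a sequence of $\mathrm{Aut}(G)$-modules).
   Context: $\widehat G=\mathrm{Hom}(G,\Bbbk^\times)$. $Z^2(G,\Bbbk^\times)$ and $B^2(G,\Bbbk^\times)$ are the groups of $2$-cocycles and $2$-coboundaries of $G$ with values in $\Bbbk^\times$ (trivial action); for $f:G\to\Bbbk^\times$, $(\delta f)(a,b)=f(a)f(b)f(ab)^{-1}$. Put $Z^2_N=\{s\in Z^2(G,\Bbbk^\times): s^2=1\}$ and $B^2_N=B^2(G,\Bbbk^\times)\cap Z^2_N$. For $\delta f\in B^2_N$ the function $f^2$ is a character of $G$, and $\Phi:B^2_N\to\widehat G$, $\Phi(\delta f)=f^2$, is a well-defined surjective homomorphism. Define $\mathbb{X}(\mathrm{triv})=Z^2_N/\ker\Phi$. $\mathrm{Alt}(G)$ is the group of bimultiplicative maps $\beta:G\times G\to\Bbbk^\times$ with $\beta(a,a)=1$ for all $a$. The first map in the sequence is the inverse of the isomorphism $B^2_N/\ker\Phi\simeq\widehat G$ induced by $\Phi$, followed by the inclusion into $Z^2_N/\ker\Phi$; the second is induced by $\underline a:Z^2(G,\Bbbk^\times)\to\mathrm{Alt}(G)$, $\underline a(z)(a,b)=z(a,b)z(b,a)^{-1}$. $\mathrm{Aut}(G)$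 (written on the right of elements of $G$; it is the group $\mathbb{A}(\mathrm{triv})$ of $C_2$-automorphisms) acts by $(\chi.\phi)(g)=\chi(g\phi^{-1})$ and $(s.\phi)(a,b)=s(a\phi^{-1},b\phi^{-1})$. *)

(* Defs.v *)
From HB Require Import structures.
From mathcomp Require Import all_boot all_order all_fingroup all_algebra all_solvable.
From mathcomp Require Import ring boolp.

Set Implicit Arguments.
Unset Strict Implicit.
Unset Printing Implicit Defensive.

Import GRing.Theory.
Local Open Scope ring_scope.
Local Open Scope quotient_scope.

(** * Modules over a finite group and short exact sequences *)

Record gmodule (A : finGroupType) := GModule {
  gmod_sort :> zmodType;
  gact : {action A &-> gmod_sort};
  gact_additive : forall a : A, zmod_morphism (gact^~ a)
}.

Definition equivariant (A : finGroupType) (M N : gmodule A) (f : M -> N) : Prop :=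
  forall (x : M) (a : A), f (gact M x a) = gact N (f x) a.

Record short_exact_seq (A : finGroupType) := ShortExactSeq {
  ses_left : gmodule A;
  ses_mid : gmodule A;
  ses_right : gmodule A;
  ses_inj : {additive ses_left -> ses_mid};
  ses_proj : {additive ses_mid -> ses_right};
  ses_inj_equivariant : equivariant ses_inj;
  ses_proj_equivariant : equivariant ses_proj;
  ses_injective : injective ses_inj;
  ses_exact : forall x : ses_mid,
    ses_proj x = 0 <-> exists y : ses_left, ses_inj y = x;
  ses_surjective : forall z : ses_right, exists x : ses_mid, ses_proj x = z
}.

Definition splits (A : finGroupType) (S : short_exact_seq A) : Prop :=
  exists sigma : {additive ses_right S -> ses_mid S},
    equivariant sigma /\ cancel sigma (ses_proj S).

(** * The multiplicative group of a field

   [kunit k] is k^x, with its group law written ADDITIVELY so that it is a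
   [zmodType]: for u, v : kunit k, [u + v] is the product in k, [0] is 1,
   [- u] is the inverse and [u *+ 2] is the square. *)

Record kunit (k : fieldType) := KUnit { kval : k; kval_neq0 : kval != 0 }.

HB.instance Definition _ (k : fieldType) := [isSub for @kval k].
HB.instance Definition _ (k : fieldType) := [Choice of kunit k by <:].

Section KUnit.
Variable k : fieldType.
Implicit Types u v w : kunit k.

Definition kunit_one : kunit k := KUnit (oner_neq0 k).
Fact kunit_mul_subproof u v : kval u * kval v != 0.
Proof. by rewrite mulf_neq0 ?kval_neq0. Qed.
Definition kunit_mul u v : kunit k := KUnit (kunit_mul_subproof u v).
Fact kunit_inv_subproof u : (kval u)^-1 != 0.
Proof. by rewrite invr_eq0 kval_neq0. Qed.
Definition kunit_inv u : kunit k := KUnit (kunit_inv_subproof u).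

Fact kunit_mulA : associative kunit_mul.
Proof. by move=> u v w; apply: val_inj; rewrite /= mulrA. Qed.
Fact kunit_mulC : commutative kunit_mul.
Proof. by move=> u v; apply: val_inj; rewrite /= mulrC. Qed.
Fact kunit_mul1 : left_id kunit_one kunit_mul.
Proof. by move=> u; apply: val_inj; rewrite /= mul1r. Qed.
Fact kunit_mulV : left_inverse kunit_one kunit_inv kunit_mul.
Proof. by move=> u; apply: val_inj; rewrite /= mulVf ?kval_neq0. Qed.

HB.instance Definition _ := GRing.isZmodule.Build (kunit k)
  kunit_mulA kunit_mulC kunit_mul1 kunit_mulV.

Lemma kval0 : kval (0 : kunit k) = 1. Proof. by []. Qed.
Lemma kvalD u v : kval (u + v) = kval u * kval v. Proof. by []. Qed.
Lemma kvalN u : kval (- u) = (kval u)^-1. Proof. by []. Qed.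
End KUnit.

Ltac kunit_abel :=
  apply: val_inj; rewrite /= ?mulr2n ?(kvalD, kvalN, kval0);
  field; rewrite ?kval_neq0 //.

Lemma kunit_sqrt (k : closedFieldType) (u : kunit k) : exists v, v *+ 2 = u.
Proof.
have [x] := @solve_monicpoly k 2 (fun i => if i == 0%N then kval u else 0) isT.
rewrite 2!big_ord_recr big_ord0 /= add0r mul0r addr0 mulr1 => xE.
have x0 : x != 0.
  by apply: contraTneq (kval_neq0 u) => x0; rewrite -xE x0 expr0n /= eqxx.
by exists (KUnit x0); rewrite mulr2n; apply: val_inj; rewrite /= -xE expr2.
Qed.

(** * Characters, cocycles, alternating bicharacters

   The finite group G is the full group [set: gT]. Because of the additive
   notation on [kunit k], the condition s^2 = 1 reads [s *+ 2 == 0]; cocycles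
   are not required to be normalized. *)

Section Groups.
Variables (k : fieldType) (gT : finGroupType).

Notation C1 := {ffun gT -> kunit k}.
Notation C2 := {ffun gT * gT -> kunit k}.
Implicit Types (f : C1) (s : C2).

Definition hom_pred : {pred C1} :=
  fun f => [forall a : gT, forall b : gT, f (a * b)%g == f a + f b].

Definition cocycle2 : {pred C2} :=
  fun s => [forall a : gT, forall b : gT, forall c : gT,
    s (a, b) + s ((a * b)%g, c) == s (b, c) + s (a, (b * c)%g)].

Definition delta f : C2 := [ffun ab => f ab.1 + f ab.2 - f (ab.1 * ab.2)%g].

Definition coboundary2 : {pred C2} := fun s => `[< exists f, s = delta f >].

Definition Z2N_pred : {pred C2} := fun s => (s \in cocycle2) && (s *+ 2 == 0).

Definition B2N_pred : {pred C2} := fun s => (s \in coboundary2) && (s \in Z2N_pred).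

Definition alt_pred : {pred C2} := fun s =>
  [&& [forall a : gT, forall b : gT, forall c : gT,
         s ((a * b)%g, c) == s (a, c) + s (b, c)],
      [forall a : gT, forall b : gT, forall c : gT,
         s (a, (b * c)%g) == s (a, b) + s (a, c)]
    & [forall a : gT, s (a, a) == 0]].

Lemma homP f :
  reflect (forall a b, f (a * b)%g = f a + f b) (f \in hom_pred).
Proof. by apply: (iffP 'forall_'forall_eqP) => H a b; apply: H. Qed.

Lemma cocycleP s :
  reflect (forall a b c,
             s (a, b) + s ((a * b)%g, c) = s (b, c) + s (a, (b * c)%g))
          (s \in cocycle2).
Proof. by apply: (iffP 'forall_'forall_'forall_eqP) => H a b c; apply: H. Qed.

Lemma coboundaryP s : reflect (exists f, s = delta f) (s \in coboundary2).
Proof. exact: asboolP. Qed.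

Lemma altP s :
  reflect [/\ forall a b c, s ((a * b)%g, c) = s (a, c) + s (b, c),
              forall a b c, s (a, (b * c)%g) = s (a, b) + s (a, c)
            & forall a, s (a, a) = 0] (s \in alt_pred).
Proof.
apply: (iffP and3P) => [] [H1 H2 H3]; split.
- by move=> a b c; apply/eqP; move/'forall_'forall_forallP: H1; apply.
- by move=> a b c; apply/eqP; move/'forall_'forall_forallP: H2; apply.
- by move=> a; apply/eqP; move/forallP: H3; apply.
- by apply/'forall_'forall_'forall_eqP.
- by apply/'forall_'forall_'forall_eqP.
- by apply/'forall_eqP.
Qed.

Fact hom_zmod : zmod_closed hom_pred.
Proof.
split=> [|f g /homP fP /homP gP].
  by apply/homP => a b; rewrite !ffunE addr0.
by apply/homP => a b; rewrite !ffunE fP gP; kunit_abel.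
Qed.
HB.instance Definition _ := GRing.isZmodClosed.Build C1 hom_pred hom_zmod.

Fact delta_is_additive : zmod_morphism delta.
Proof. by move=> f g; apply/ffunP => -[a b]; rewrite !ffunE /=; kunit_abel. Qed.
HB.instance Definition _ := GRing.isZmodMorphism.Build C1 C2 delta delta_is_additive.

Lemma delta_cocycle f : delta f \in cocycle2.
Proof. by apply/cocycleP => a b c; rewrite !ffunE /= mulgA; kunit_abel. Qed.

Fact cocycle_zmod : zmod_closed cocycle2.
Proof.
split=> [|s t /cocycleP sP /cocycleP tP].
  by apply/cocycleP => a b c; rewrite !ffunE.
apply/cocycleP => a b c; rewrite !ffunE.
have -> : s (a, b) = s (b, c) + s (a, (b * c)%g) - s ((a * b)%g, c).
  by rewrite -sP addrK.
have -> : t (a, b) = t (b, c) + t (a, (b * c)%g) - t ((a * b)%g, c).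
  by rewrite -tP addrK.
by kunit_abel.
Qed.
HB.instance Definition _ := GRing.isZmodClosed.Build C2 cocycle2 cocycle_zmod.

Fact Z2N_zmod : zmod_closed Z2N_pred.
Proof.
split=> [|s t /andP[sZ s2] /andP[tZ t2]]; rewrite /Z2N_pred -topredE /=.
  by rewrite rpred0 mul0rn eqxx.
by rewrite rpredB // mulrnBl (eqP s2) (eqP t2) subr0 eqxx.
Qed.
HB.instance Definition _ := GRing.isZmodClosed.Build C2 Z2N_pred Z2N_zmod.

Fact B2N_zmod : zmod_closed B2N_pred.
Proof.
split=> [|s t /andP[/coboundaryP[f sE] sN] /andP[/coboundaryP[g tE] tN]];
  rewrite /B2N_pred -topredE /=.
  by rewrite rpred0 andbT; apply/coboundaryP; exists 0; rewrite raddf0.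
rewrite rpredB // andbT; apply/coboundaryP; exists (f - g).
by rewrite sE tE raddfB.
Qed.
HB.instance Definition _ := GRing.isZmodClosed.Build C2 B2N_pred B2N_zmod.

Fact alt_zmod : zmod_closed alt_pred.
Proof.
split=> [|s t /altP[s1 s2 s0] /altP[t1 t2 t0]]; apply/altP.
  by split=> [a b c|a b c|a]; rewrite !ffunE // addr0.
split=> [a b c|a b c|a]; rewrite !ffunE ?s1 ?t1 ?s2 ?t2 ?s0 ?t0 ?subr0 //.
  by kunit_abel.
by kunit_abel.
Qed.
HB.instance Definition _ := GRing.isZmodClosed.Build C2 alt_pred alt_zmod.

(* The groups hat G, Z^2_N, B^2_N and Alt(G). *)
Record charG := CharG { charG_val :> C1; charG_valP : charG_val \in hom_pred }.
HB.instance Definition _ := [isSub for charG_val].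
HB.instance Definition _ := [Choice of charG by <:].
HB.instance Definition _ := [SubChoice_isSubZmodule of charG by <:].

Record Z2N := MkZ2N { Z2N_val :> C2; Z2N_valP : Z2N_val \in Z2N_pred }.
HB.instance Definition _ := [isSub for Z2N_val].
HB.instance Definition _ := [Choice of Z2N by <:].
HB.instance Definition _ := [SubChoice_isSubZmodule of Z2N by <:].

Record B2N := MkB2N { B2N_val :> C2; B2N_valP : B2N_val \in B2N_pred }.
HB.instance Definition _ := [isSub for B2N_val].
HB.instance Definition _ := [Choice of B2N by <:].
HB.instance Definition _ := [SubChoice_isSubZmodule of B2N by <:].

Record altG := AltG { altG_val :> C2; altG_valP : altG_val \in alt_pred }.
HB.instance Definition _ := [isSub for altG_val].
HB.instance Definition _ := [Choice of altG by <:].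
HB.instance Definition _ := [SubChoice_isSubZmodule of altG by <:].

Fact B2N_incl_subproof (t : B2N) : val t \in Z2N_pred.
Proof. by case/andP: (B2N_valP t). Qed.
Definition B2N_incl (t : B2N) : Z2N := MkZ2N (B2N_incl_subproof t).

Fact B2N_incl_is_additive : zmod_morphism B2N_incl.
Proof. by move=> t u; apply: val_inj; rewrite raddfB; exact: (raddfB val t u). Qed.
HB.instance Definition _ :=
  GRing.isZmodMorphism.Build B2N Z2N B2N_incl B2N_incl_is_additive.

Fact B2N_ex (t : B2N) : exists f, val t = delta f.
Proof. by case/andP: (B2N_valP t) => /coboundaryP. Qed.

Lemma delta_sq_hom f : (delta f *+ 2 == 0) = (f *+ 2 \in hom_pred).
Proof.
rewrite !mulr2n; apply/eqP/homP => [/ffunP f2 a b|f2].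
  apply/eqP; rewrite eq_sym -subr_eq0; apply/eqP.
  by have := f2 (a, b); rewrite !ffunE /= => <-; kunit_abel.
apply/ffunP => -[a b]; have /eqP := f2 a b.
by rewrite eq_sym -subr_eq0 => /eqP fab; rewrite !ffunE /= -fab !ffunE; kunit_abel.
Qed.

Fact Phi_subproof (t : B2N) : sval (cid (B2N_ex t)) *+ 2 \in hom_pred.
Proof.
rewrite -delta_sq_hom -(svalP (cid (B2N_ex t))).
by case/andP: (B2N_valP t) => _ /andP[].
Qed.

(* delta f |-> f^2 for a chosen f; for G of exponent 2 the value does not depend
   on f, see [PhiE] below. *)
Definition Phi_fun (t : B2N) : charG := CharG (Phi_subproof t).

Definition antisym (s : C2) : C2 := [ffun ab => s (ab.1, ab.2) - s (ab.2, ab.1)].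

Fact antisym_is_additive : zmod_morphism antisym.
Proof. by move=> s t; apply/ffunP => -[a b]; rewrite !ffunE /=; kunit_abel. Qed.
HB.instance Definition _ :=
  GRing.isZmodMorphism.Build C2 C2 antisym antisym_is_additive.

End Groups.

(** * The action of Aut(G)

   [AutG gT] is Aut(G) as a group type; the product of {perm gT} applies the
   left factor first, so automorphisms act on the right of elements of G. *)

Definition AutG (gT : finGroupType) : finGroupType := [subg Aut [set: gT]].

Section Action.
Variables (k : fieldType) (gT : finGroupType).
Notation C1 := {ffun gT -> kunit k}.
Notation C2 := {ffun gT * gT -> kunit k}.
Implicit Types (phi psi : AutG gT) (f : C1) (s : C2).

Definition autV phi (a : gT) : gT := ((sgval phi)^-1)%g a.

Lemma autVM phi a b : autV phi (a * b)%g = (autV phi a * autV phi b)%g.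
Proof.
have phiA : ((sgval phi)^-1)%g \in Aut [set: gT] by rewrite groupV subgP.
by have /morphicP := Aut_morphic phiA; apply; rewrite inE.
Qed.

Lemma autV1 a : autV 1%g a = a.
Proof. by rewrite /autV morph1 invg1 perm1. Qed.

Lemma autV_mul phi psi a : autV (phi * psi)%g a = autV phi (autV psi a).
Proof. by rewrite /autV morphM ?inE // invMg permM. Qed.

Definition act1 f phi : C1 := [ffun a => f (autV phi a)].
Definition act2 s phi : C2 := [ffun ab => s (autV phi ab.1, autV phi ab.2)].

Lemma act11 f : act1 f 1%g = f.
Proof. by apply/ffunP => a; rewrite ffunE autV1. Qed.
Lemma act1M f : act_morph act1 f.
Proof. by move=> phi psi; apply/ffunP => a; rewrite !ffunE autV_mul. Qed.
Lemma act1B phi : zmod_morphism (act1^~ phi).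
Proof. by move=> f g; apply/ffunP => a; rewrite !ffunE. Qed.

Lemma act21 s : act2 s 1%g = s.
Proof. by apply/ffunP => -[a b]; rewrite ffunE /= !autV1. Qed.
Lemma act2M s : act_morph act2 s.
Proof. by move=> phi psi; apply/ffunP => -[a b]; rewrite !ffunE /= !autV_mul. Qed.
Lemma act2B phi : zmod_morphism (act2^~ phi).
Proof. by move=> s t; apply/ffunP => -[a b]; rewrite !ffunE. Qed.

Lemma act_delta f phi : act2 (delta f) phi = delta (act1 f phi).
Proof. by apply/ffunP => -[a b]; rewrite !ffunE /= autVM. Qed.

Lemma act_antisym s phi : act2 (antisym s) phi = antisym (act2 s phi).
Proof. by apply/ffunP => -[a b]; rewrite !ffunE. Qed.

Fact charG_act_subproof (chi : charG k gT) phi : act1 chi phi \in @hom_pred k gT.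
Proof. by apply/homP => a b; rewrite !ffunE autVM (homP _ (charG_valP chi)). Qed.
Definition charG_act chi phi : charG k gT := CharG (charG_act_subproof chi phi).

Fact altG_act_subproof (beta : altG k gT) phi : act2 beta phi \in @alt_pred k gT.
Proof.
have [b1 b2 b0] := altP _ (altG_valP beta).
by apply/altP; split=> *; rewrite !ffunE /= ?autVM ?b1 ?b2 ?b0.
Qed.
Definition altG_act beta phi : altG k gT := AltG (altG_act_subproof beta phi).

Fact Z2N_act_subproof (s : Z2N k gT) phi : act2 s phi \in @Z2N_pred k gT.
Proof.
have /andP[/cocycleP sZ s2] := Z2N_valP s; apply/andP; split.
  by apply/cocycleP => a b c; rewrite !ffunE /= !autVM sZ.
by move: s2; rewrite !mulr2n => /eqP/ffunP s2;
   apply/eqP/ffunP => -[a b]; have := s2 (autV phi a, autV phi b); rewrite !ffunE.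
Qed.
Definition Z2N_act (s : Z2N k gT) phi : Z2N k gT := MkZ2N (Z2N_act_subproof s phi).

Fact B2N_act_subproof (t : B2N k gT) phi : act2 t phi \in @B2N_pred k gT.
Proof.
apply/andP; split; last exact: (Z2N_act_subproof (B2N_incl t)).
by have [f tE] := B2N_ex t; apply/coboundaryP; exists (act1 f phi);
   rewrite -act_delta -tE.
Qed.
Definition B2N_act t phi : B2N k gT := MkB2N (B2N_act_subproof t phi).

Lemma charG_act1 chi : charG_act chi 1%g = chi.
Proof. by apply: val_inj; apply: act11. Qed.
Lemma charG_actM chi : act_morph charG_act chi.
Proof. by move=> phi psi; apply: val_inj; apply: act1M. Qed.
Lemma charG_actB phi : zmod_morphism (charG_act^~ phi).
Proof. by move=> chi psi; apply: val_inj; apply: act1B. Qed.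

Lemma altG_act1 beta : altG_act beta 1%g = beta.
Proof. by apply: val_inj; apply: act21. Qed.
Lemma altG_actM beta : act_morph altG_act beta.
Proof. by move=> phi psi; apply: val_inj; apply: act2M. Qed.
Lemma altG_actB phi : zmod_morphism (altG_act^~ phi).
Proof. by move=> s t; apply: val_inj; apply: act2B. Qed.

Lemma Z2N_act1 (s : Z2N k gT) : Z2N_act s 1%g = s.
Proof. by apply: val_inj; apply: act21. Qed.
Lemma Z2N_actM (s : Z2N k gT) : act_morph Z2N_act s.
Proof. by move=> phi psi; apply: val_inj; apply: act2M. Qed.
Lemma Z2N_actB phi : zmod_morphism (Z2N_act^~ phi).
Proof. by move=> s t; apply: val_inj; apply: act2B. Qed.

Definition charG_mod : gmodule (AutG gT) :=
  @GModule (AutG gT) (charG k gT) (TotalAction charG_act1 charG_actM) charG_actB.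
Definition altG_mod : gmodule (AutG gT) :=
  @GModule (AutG gT) (altG k gT) (TotalAction altG_act1 altG_actM) altG_actB.

End Action.

(** * The modules and maps of the sequence, for G an elementary 2-group *)

Section Sequence.
Variables (k : closedFieldType) (gT : finGroupType).
Hypothesis abelG : (2.-abelem [set: gT])%g.

Notation C1 := {ffun gT -> kunit k}.
Notation C2 := {ffun gT * gT -> kunit k}.
Implicit Types (phi : AutG gT) (chi : charG k gT) (t : B2N k gT) (s : Z2N k gT).

Lemma elemC (a b : gT) : (a * b = b * a)%g.
Proof.
by have /abelem_abelian/centsP/(_ a (in_setT a) b (in_setT b)) := abelG.
Qed.

Lemma elem_sq (a : gT) : (a * a = 1)%g.
Proof.
by have /(_ a (in_setT a)) := (abelemP (isT : prime 2) abelG).2; rewrite expgS expg1.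
Qed.

Lemma char_sq (f : C1) : f \in @hom_pred k gT -> f *+ 2 = 0.
Proof.
move=> /homP fH; have f1 : f 1%g = 0.
  by apply: (addrI (f 1%g)); rewrite addr0 -fH mulg1.
by rewrite mulr2n; apply/ffunP => a; rewrite !ffunE -fH elem_sq.
Qed.

(* The hypothesis on G is an argument because it is what makes Phi independent
   of the choice of f, hence additive. *)
Definition Phi of (2.-abelem [set: gT])%g : B2N k gT -> charG k gT := @Phi_fun k gT.
Arguments Phi : simpl never.

Lemma PhiE (f : C1) t : val t = delta f -> val (Phi abelG t) = f *+ 2.
Proof.
rewrite /Phi /=; case: cid => g /= -> fg.
apply/eqP; rewrite -subr_eq0 -mulrnBl; apply/eqP/char_sq/homP => a b.
have /ffunP/(_ (a, b)) := fg; rewrite !ffunE /= => gab.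
have -> : g a = g a + g b - g (a * b)%g + g (a * b)%g - g b by kunit_abel.
by rewrite gab; kunit_abel.
Qed.

Fact Phi_is_additive : zmod_morphism (Phi abelG).
Proof.
move=> t u; apply: val_inj; have [f tE] := B2N_ex t; have [g uE] := B2N_ex u.
have tuE : val (t - u) = delta (f - g) by rewrite delta_is_additive -tE -uE; exact: (raddfB val t u).
by rewrite (PhiE tuE) mulrnBl -(PhiE tE) -(PhiE uE); exact/esym/raddfB.
Qed.
HB.instance Definition _ :=
  GRing.isZmodMorphism.Build (B2N k gT) (charG k gT) (Phi abelG) Phi_is_additive.

Lemma Phi_surj chi : exists t, Phi abelG t = chi.
Proof.
pose f : C1 := [ffun a => sval (cid (kunit_sqrt (chi a)))].
have f2 : f *+ 2 = chi.
  rewrite mulr2n; apply/ffunP => a; rewrite !ffunE -mulr2n.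
  exact: (svalP (cid (kunit_sqrt (chi a)))).
have fB : delta f \in @B2N_pred k gT.
  rewrite /B2N_pred -topredE /=; apply/andP; split; first by apply/coboundaryP; exists f.
  by apply/andP; rewrite delta_cocycle delta_sq_hom f2 charG_valP.
by exists (MkB2N fB); apply: val_inj; rewrite (@PhiE f).
Qed.

Definition kerPhi of (2.-abelem [set: gT])%g : {pred Z2N k gT} :=
  fun s => `[< exists t, B2N_incl t = s /\ Phi abelG t = 0 >].

Lemma kerPhiP s :
  reflect (exists t, B2N_incl t = s /\ Phi abelG t = 0) (s \in kerPhi abelG).
Proof. exact: asboolP. Qed.

Fact kerPhi_zmod : zmod_closed (kerPhi abelG).
Proof.
split=> [|s s' /kerPhiP[t [<- t0]] /kerPhiP[u [<- u0]]]; apply/kerPhiP.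
  by exists 0; rewrite !raddf0.
by exists (t - u); rewrite B2N_incl_is_additive Phi_is_additive t0 u0 subr0.
Qed.
HB.instance Definition _ :=
  GRing.isZmodClosed.Build (Z2N k gT) (kerPhi abelG) kerPhi_zmod.

Lemma B2N_incl_inj : injective (@B2N_incl k gT).
Proof. by move=> t u /(congr1 val) tu; apply: val_inj. Qed.

Lemma kerPhi_incl t : (B2N_incl t \in kerPhi abelG) = (Phi abelG t == 0).
Proof.
apply/kerPhiP/eqP => [[u [/B2N_incl_inj -> //]]|t0]; by exists t.
Qed.

(* X(triv) = Z^2_N / ker Phi; [Quotient.quot] is the quotient of a [zmodType] by
   any [zmodClosed] predicate. *)
Definition Xtriv := Quotient.quot (kerPhi abelG).
HB.instance Definition _ := Quotient.on Xtriv.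
HB.instance Definition _ := GRing.Zmodule.on Xtriv.

Definition Xclass : Z2N k gT -> Xtriv := \pi_Xtriv.

Lemma Xclass_eq s s' : (Xclass s == Xclass s') = (s - s' \in kerPhi abelG).
Proof. by rewrite Quotient.idealrBE. Qed.

Lemma Xclass_repr (x : Xtriv) : Xclass (generic_quotient.repr x) = x.
Proof. exact: generic_quotient.reprK. Qed.

Fact Xclass_is_additive : zmod_morphism Xclass.
Proof. exact: pi_is_zmod_morphism. Qed.
HB.instance Definition _ :=
  GRing.isZmodMorphism.Build (Z2N k gT) Xtriv Xclass Xclass_is_additive.

Lemma Phi_act t phi : Phi abelG (B2N_act t phi) = charG_act (Phi abelG t) phi.
Proof.
have [f tE] := B2N_ex t; apply: val_inj.
rewrite (@PhiE (act1 f phi)); last by rewrite -act_delta -tE.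
change (act1 f phi *+ 2 = act1 (val (Phi abelG t)) phi).
by rewrite (PhiE tE) !mulr2n; apply/ffunP => a; rewrite !ffunE.
Qed.

Lemma kerPhi_act s phi : s \in kerPhi abelG -> Z2N_act s phi \in kerPhi abelG.
Proof.
case/kerPhiP => t [<- t0].
have -> : Z2N_act (B2N_incl t) phi = B2N_incl (B2N_act t phi) by apply: val_inj.
rewrite kerPhi_incl Phi_act t0; apply/eqP/val_inj.
by apply/ffunP => a; rewrite !ffunE.
Qed.

(* [generic_quotient.repr] picks a representative; see [Xact_class]. *)
Definition Xact (x : Xtriv) phi : Xtriv := Xclass (Z2N_act (generic_quotient.repr x) phi).

Lemma Xact_class s phi : Xact (Xclass s) phi = Xclass (Z2N_act s phi).
Proof.
apply/eqP; rewrite /Xact Xclass_eq -Z2N_actB kerPhi_act //.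
by rewrite -Xclass_eq Xclass_repr.
Qed.

Lemma Xact1 x : Xact x 1%g = x.
Proof. by rewrite -[x]Xclass_repr Xact_class Z2N_act1. Qed.
Lemma XactM x : act_morph Xact x.
Proof. by move=> phi psi; rewrite -[x]Xclass_repr !Xact_class Z2N_actM. Qed.
Lemma XactB phi : zmod_morphism (Xact^~ phi).
Proof.
move=> x y; rewrite -[x]Xclass_repr -[y]Xclass_repr -Xclass_is_additive.
by rewrite !Xact_class Z2N_actB Xclass_is_additive.
Qed.

Definition Xtriv_mod : gmodule (AutG gT) :=
  @GModule (AutG gT) Xtriv (TotalAction Xact1 XactM) XactB.

(* Inverse of the isomorphism B2N / ker Phi ~ hat G, followed by the inclusion. *)
Definition iota (chi : charG k gT) : Xtriv :=
  Xclass (B2N_incl (sval (cid (Phi_surj chi)))).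

Lemma iota_Phi t : iota (Phi abelG t) = Xclass (B2N_incl t).
Proof.
rewrite /iota; case: cid => u /= tu.
apply/eqP; rewrite Xclass_eq -B2N_incl_is_additive kerPhi_incl.
by rewrite Phi_is_additive tu subrr.
Qed.

Fact iota_is_additive : zmod_morphism iota.
Proof.
move=> chi psi; have [t <-] := Phi_surj chi; have [u <-] := Phi_surj psi.
rewrite -Phi_is_additive !iota_Phi B2N_incl_is_additive.
exact: Xclass_is_additive.
Qed.
HB.instance Definition _ :=
  GRing.isZmodMorphism.Build (charG k gT) Xtriv iota iota_is_additive.

Lemma antisym_alt (s : C2) : s \in @cocycle2 k gT -> antisym s \in @alt_pred k gT.
Proof.
move/cocycleP => sZ.
have lin a b c : antisym s (a, (b * c)%g) = antisym s (a, b) + antisym s (a, c).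
  rewrite !ffunE /=.
  have H1 := sZ a b c; have H2 := sZ b c a; have H3 := sZ b a c.
  rewrite (elemC c a) in H2; rewrite (elemC b a) in H3.
  have -> : s (a, (b * c)%g) = s (b, c) + s (a, (b * c)%g) - s (b, c) by kunit_abel.
  rewrite -H1.
  have -> : s ((b * c)%g, a) = s (b, c) + s ((b * c)%g, a) - s (b, c) by kunit_abel.
  rewrite H2.
  have -> : s ((a * b)%g, c) = s (b, a) + s ((a * b)%g, c) - s (b, a) by kunit_abel.
  by rewrite H3; kunit_abel.
have anti a b : antisym s (a, b) = - antisym s (b, a).
  by rewrite !ffunE /=; kunit_abel.
apply/altP; split=> // [a b c|a].
  by rewrite anti lin opprD -!anti.
by rewrite ffunE /= subrr.
Qed.

Fact abar_subproof (s : Z2N k gT) : antisym s \in @alt_pred k gT.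
Proof. by apply: antisym_alt; case/andP: (Z2N_valP s). Qed.
Definition abar (s : Z2N k gT) : altG k gT := AltG (abar_subproof s).

Fact abar_is_additive : zmod_morphism abar.
Proof.
move=> s s'; apply: val_inj.
change (antisym (val (s - s')) = val (abar s - abar s')).
have -> : val (s - s') = val s - val s' by exact: (raddfB val s s').
by rewrite antisym_is_additive; exact/esym/raddfB.
Qed.

Lemma abar_incl t : abar (B2N_incl t) = 0.
Proof.
apply: val_inj; have [f tE] := B2N_ex t; rewrite /= tE.
by apply/ffunP => -[a b]; rewrite !ffunE /= (elemC b a); kunit_abel.
Qed.

(* See [Xproj_class]: the map induced by [abar] on classes. *)
Definition Xproj (x : Xtriv) : altG k gT := abar (generic_quotient.repr x).

Lemma Xproj_class s : Xproj (Xclass s) = abar s.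
Proof.
apply/eqP; rewrite -subr_eq0 /Xproj -abar_is_additive.
have : generic_quotient.repr (Xclass s) - s \in kerPhi abelG by rewrite -Xclass_eq Xclass_repr.
by case/kerPhiP => t [<- _]; rewrite abar_incl.
Qed.

Fact Xproj_is_additive : zmod_morphism Xproj.
Proof.
move=> x y; rewrite -[x]Xclass_repr -[y]Xclass_repr -Xclass_is_additive.
by rewrite !Xproj_class abar_is_additive.
Qed.
HB.instance Definition _ :=
  GRing.isZmodMorphism.Build Xtriv (altG k gT) Xproj Xproj_is_additive.

Lemma iota_equivariant : @equivariant _ (charG_mod k gT) Xtriv_mod iota.
Proof.
move=> chi phi /=; have [t <-] := Phi_surj chi.
rewrite -Phi_act !iota_Phi Xact_class; congr Xclass; exact: val_inj.
Qed.

Lemma Xproj_equivariant : @equivariant _ Xtriv_mod (altG_mod k gT) Xproj.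
Proof.
move=> x phi /=; rewrite -[x]Xclass_repr Xact_class !Xproj_class.
by apply: val_inj; rewrite /= act_antisym.
Qed.

Lemma iota_inj : injective iota.
Proof.
move=> chi psi; have [t <-] := Phi_surj chi; have [u <-] := Phi_surj psi.
rewrite !iota_Phi => /eqP; rewrite Xclass_eq -B2N_incl_is_additive kerPhi_incl.
by rewrite Phi_is_additive subr_eq0 => /eqP.
Qed.

Lemma elem_join (H : {group gT}) (x a : gT) :
  (a \in H <*> <[x]>)%g -> a \in H \/ (a * x)%g \in H.
Proof.
rewrite cent_joinEr; last by apply/centsP => u _ v _; apply: elemC.
case/mulsgP => h y hH /cycleP[i ->] ->.
have -> : (x ^+ i = x ^+ odd i)%g.
  by rewrite -{1}(odd_double_half i) expgD -mul2n expgM expgS expg1 elem_sq expg1n mulg1.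
by case: (odd i); [right; rewrite expg1 -mulgA elem_sq mulg1|left; rewrite expg0 mulg1].
Qed.

Lemma elem_ind (P : {group gT} -> Prop) :
  P 1%G -> (forall (H : {group gT}) x, x \notin H -> P H -> P (H <*> <[x]>)%G) ->
  P [set: gT]%G.
Proof.
move=> P1 PS; have Q1 : `[< P 1%G >] by apply/asboolP.
case: (@arg_maxnP _ 1%G (fun H => `[< P H >]) (fun H : {group gT} => #|H|) Q1) => H.
move=> /asboolP PH Hmax.
have [HT|] := eqVneq H [set: gT]%G; first by rewrite -HT.
rewrite -val_eqE /= eqEsubset subsetT /= => /subsetPn[x _ xH].
have /asboolP/Hmax := PS H x xH PH.
rewrite /= leqNgt => /negP[]; apply: proper_card.
rewrite properE joing_subl; apply/subsetPn; exists x => //.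
by rewrite mem_gen // inE cycle_id orbT.
Qed.

Lemma sym_cocycle_coboundary (s : C2) :
  s \in @cocycle2 k gT -> (forall a b, s (a, b) = s (b, a)) ->
  s \in @coboundary2 k gT.
Proof.
move=> /cocycleP sZ sC.
pose P (H : {group gT}) := exists f : C1,
  {in H &, forall a b, f a + f b - f (a * b)%g = s (a, b)}.
have s11 a : s (a, 1%g) = s (1%g, 1%g).
  by have := sZ a 1%g 1%g; rewrite !mulg1 => /addIr.
suff: P [set: gT]%G.
  case=> f fP; apply/coboundaryP; exists f.
  by apply/ffunP => -[a b]; rewrite ffunE /= fP ?inE.
apply: elem_ind => [|H x xH [f fP]].
  exists [ffun=> s (1%g, 1%g)] => a b /set1P -> /set1P ->.
  by rewrite !ffunE addrK.
have [r r2] := kunit_sqrt (s (x, x) + s (1%g, 1%g)).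
have xxK a : (a * x * x = a)%g by rewrite -mulgA elem_sq mulg1.
have inHx a : a \in H -> (a * x)%g \notin H.
  by move=> aH; rewrite groupMl.
pose F : C1 := [ffun g => if g \in H then f g else f (g * x)%g + r - s ((g * x)%g, x)].
have FH a : a \in H -> F a = f a by move=> aH; rewrite ffunE aH.
have FHx a : a \in H -> F (a * x)%g = f a + r - s (a, x).
  by move=> aH; rewrite ffunE (negPf (inHx a aH)) xxK.
have mix a b : a \in H -> b \in H ->
    F a + F (b * x)%g - F (a * (b * x))%g = s (a, (b * x)%g).
  move=> aH bH; rewrite mulgA FH ?FHx ?groupM //.
  have -> : s (a, (b * x)%g) = s (b, x) + s (a, (b * x)%g) - s (b, x) by kunit_abel.
  by rewrite -sZ -(fP a b) //; kunit_abel.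
exists F => a b /elem_join[aH|aH] /elem_join[bH|bH].
- by rewrite !FH ?groupM ?fP.
- by rewrite -(xxK b) mix.
- by rewrite -(xxK a) [F _ + _]addrC (elemC _ b) mix // sC.
set c := (a * x)%g in aH; set d := (b * x)%g in bH.
rewrite -(xxK a) -(xxK b) -/c -/d.
have -> : (c * x * (d * x) = c * d)%g by rewrite (elemC d) mulgA xxK.
rewrite (FHx c) // (FHx d) // (FH _ (groupM aH bH)).
have E1 := sZ (c * x)%g d x; have E2 := sZ d c x; have E3 := sZ (c * d)%g x x.
rewrite elem_sq s11 in E3.
rewrite -(mulgA c x d) (elemC x d) (mulgA c d x) (sC _ d) in E1.
have -> : s ((c * x)%g, (d * x)%g)
  = s (d, x) + s ((c * x)%g, (d * x)%g) - s (d, x) by kunit_abel.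
rewrite -E1.
have -> : s (d, (c * x)%g) = s (c, x) + s (d, (c * x)%g) - s (c, x) by kunit_abel.
rewrite -E2 (elemC d c).
have -> : s ((c * d * x)%g, x)
  = s ((c * d)%g, x) + s ((c * d * x)%g, x) - s ((c * d)%g, x) by kunit_abel.
by rewrite E3 -r2 (sC d c) -(fP c d) //; kunit_abel.
Qed.

Lemma Xproj_ker (x : Xtriv) : Xproj x = 0 <-> exists chi, iota chi = x.
Proof.
split=> [|[chi <-]]; last first.
  by have [t <-] := Phi_surj chi; rewrite iota_Phi Xproj_class abar_incl.
rewrite -[x]Xclass_repr; set s := generic_quotient.repr x; rewrite Xproj_class => s0.
have /andP[sZ _] := Z2N_valP s.
have sB : val s \in @B2N_pred k gT.
  apply/andP; split; last exact: Z2N_valP.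
  apply: sym_cocycle_coboundary => // a b; apply/eqP; rewrite -subr_eq0; apply/eqP.
  by have /(congr1 val)/ffunP/(_ (a, b)) := s0; rewrite !ffunE.
exists (Phi abelG (MkB2N sB)); rewrite iota_Phi; congr Xclass; exact: val_inj.
Qed.

Lemma Xproj_surj (beta : altG k gT) : exists x, Xproj x = beta.
Proof.
have [b1 b2 b0] := altP _ (altG_valP beta).
have beta2 a b : beta (a, b) + beta (a, b) = 0.
  have be1 : beta (a, 1%g) = 0.
    by apply: (addrI (beta (a, 1%g))); rewrite addr0 -b2 mulg1.
  by rewrite -b2 elem_sq.
pose P (H : {group gT}) := exists s : C2,
  [/\ {in H & &, forall a b c, s ((a * b)%g, c) = s (a, c) + s (b, c)},
      {in H & &, forall a b c, s (a, (b * c)%g) = s (a, b) + s (a, c)},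
      {in H &, forall a b, s (a, b) + s (b, a) = beta (a, b)}
    & s + s = 0].
suff: P [set: gT]%G.
  case=> s [s1 s2 sA s0].
  have sN a b : - s (a, b) = s (a, b).
    by apply/eqP; rewrite eq_sym -subr_eq0 opprK; have /ffunP/(_ (a, b)) := s0;
       rewrite !ffunE => ->.
  have sZ : s \in @Z2N_pred k gT.
    apply/andP; split; last by rewrite mulr2n s0.
    by apply/cocycleP => a b c; rewrite s1 ?s2 ?inE //; kunit_abel.
  exists (Xclass (MkZ2N sZ)); rewrite Xproj_class; apply: val_inj.
  by apply/ffunP => -[a b]; rewrite ffunE /= sN sA ?inE.
apply: elem_ind => [|H x xH [s [s1 s2 sA s0]]].
  exists 0; split=> [a b c _ _ _|a b c _ _ _|a b|]; rewrite ?ffunE ?addr0 //.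
  by move=> /set1P -> /set1P ->; rewrite b0.
pose h g := if g \in H then g else (g * x)%g.
pose u g := if g \in H then 1%g else x.
have hu g : g = (h g * u g)%g.
  by rewrite /h /u; case: ifP => _; rewrite ?mulg1 // -mulgA elem_sq mulg1.
have hH g : (g \in H <*> <[x]>)%g -> h g \in H.
  by case/elem_join => gH; rewrite /h; [rewrite gH | case: ifP].
have hM : {in (H <*> <[x]>)%G &, {morph h : a b / (a * b)%g}}.
  move=> a b aK bK; have haH := hH a aK; have hbH := hH b bK.
  have habH := hH _ (groupM aK bK); move: haH hbH habH; rewrite /h.
  case: ifP => aH; case: ifP => bH.
  - by rewrite groupM.
  - by rewrite (groupMl b aH) bH mulgA.
  - by rewrite (groupMr a bH) aH -!mulgA (elemC x).
  move=> axH bxH.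
  have abE : (a * x * (b * x) = a * b)%g.
    by rewrite (elemC b) mulgA -(mulgA a) elem_sq mulg1.
  by rewrite -abE (groupM axH bxH).
have uu a b : beta (u a, u b) = 0.
  have be1 c : beta (c, 1%g) = 0.
    by apply: (addrI (beta (c, 1%g))); rewrite addr0 -b2 mulg1.
  have be1' c : beta (1%g, c) = 0.
    by apply: (addrI (beta (1%g, c))); rewrite addr0 -b1 mulg1.
  by rewrite /u; case: ifP => _; case: ifP => _; rewrite ?be1 ?be1' ?b0.
have sym a b : beta (a, b) = beta (b, a).
  have := b0 (a * b)%g; rewrite b1 !b2 !b0 add0r addr0 => ab.
  by apply: (addrI (beta (b, a))); rewrite addrC ab beta2.
pose S : C2 := [ffun ab => s (h ab.1, h ab.2) + beta (h ab.1, (h ab.2 * ab.2)%g)].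
exists S; split=> [a b c aK bK cK|a b c aK bK cK|a b aK bK|].
- by rewrite !ffunE /= hM // s1 ?hH // b1; kunit_abel.
- by rewrite !ffunE /= hM // s2 ?hH // !b2; kunit_abel.
- rewrite !ffunE /= [RHS](_ : _ = beta (h a, b) + beta (u a, h b)); last first.
    by rewrite {1}(hu a) b1; congr (_ + _); rewrite {1}(hu b) b2 uu addr0.
  have ua : (h a * a = u a)%g by rewrite {2}(hu a) mulgA elem_sq mul1g.
  rewrite ua b2 (sym (u a)).
  rewrite [LHS](_ : _ = s (h a, h b) + s (h b, h a) + beta (h a, h b)
                        + (beta (h a, b) + beta (h b, u a))); last by kunit_abel.
  by rewrite sA ?hH // beta2 add0r.
apply/ffunP => -[a b]; rewrite !ffunE /=.
rewrite addrACA beta2 addr0.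
by have /ffunP/(_ (h a, h b)) := s0; rewrite !ffunE.
Qed.

Definition Xtriv_ses : short_exact_seq (AutG gT) :=
  @ShortExactSeq (AutG gT) (charG_mod k gT) Xtriv_mod (altG_mod k gT)
    (iota : {additive charG k gT -> Xtriv}) (Xproj : {additive Xtriv -> altG k gT})
    iota_equivariant Xproj_equivariant iota_inj Xproj_ker Xproj_surj.

End Sequence.

(* Main.v *)
(* Sending a cocycle s to the function a |-> s(a,a)/s(1,1) turns X(triv) into
   quadratic forms on the F_2-space G, the map to Alt(G) into polarization and
   hat G into the squares of linear forms. An equivariant section would choose
   for l /\ m a quadratic form invariant under its stabilizer; invariance under
   the transvection x |-> x + m(x) e forces that form to take the value -1 at any
   e with l(e) = 1 and m(e) = 0, when m is nonzero. For independent l, m, m' and e with l(e) = 1, m(e) = m'(e) = 0,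
   additivity on l /\ (m + m') = l /\ m + l /\ m' would give -1 = (-1)(-1). *)
Require Import Defs.
From HB Require Import structures.
From mathcomp Require Import all_boot all_order all_fingroup all_algebra all_solvable.
From mathcomp Require Import mxabelem ring.

Set Implicit Arguments.
Unset Strict Implicit.
Unset Printing Implicit Defensive.

Import GRing.Theory.
Local Open Scope ring_scope.

Lemma autV_id (gT : finGroupType) (phi : AutG gT) : autV phi 1%g = 1%g.
Proof. by apply: (mulgI (autV phi 1%g)); rewrite -autVM !mulg1. Qed.

(** * Squares in the central extension of a cocycle *)

Section Squaring.
Variables (k : fieldType) (gT : finGroupType).
Implicit Types (s : {ffun gT * gT -> kunit k}).

(* In the central extension defined by the cocycle [s], this is the square of
   a lift of [a]. *)
Definition squaring s : {ffun gT -> kunit k} :=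
  [ffun a => s (a, a) - s (1%g, 1%g)].

Lemma squaring_is_additive : zmod_morphism squaring.
Proof. by move=> s t; apply/ffunP => a; rewrite !ffunE; kunit_abel. Qed.

Lemma squaring_act s phi : squaring (act2 s phi) = Defs.act1 (squaring s) phi.
Proof. by apply/ffunP => a; rewrite !ffunE /= autV_id. Qed.

End Squaring.

Section QuadraticForm.
Variables (k : closedFieldType) (gT : finGroupType).
Hypothesis abelG : (2.-abelem [set: gT])%g.
Implicit Types (s : Z2N k gT) (x : Xtriv k abelG).

(** For lifts u_a with u_a u_b = s(a,b) u_ab, the square of u_a u_b equals that of u_ab because s^2
    = 1; reordering its factors costs the commutator [abar]. *)
Lemma squaringM s a b :
  squaring s (a * b)%g = squaring s a + squaring s b + abar abelG s (a, b).
Proof.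
have /andP[/cocycleP sZ s2] := Z2N_valP s.
have s11 c : s (1%g, c) = s (1%g, 1%g).
  by have := sZ 1%g 1%g c; rewrite !mul1g => /addIr.
have E1 := sZ a b (a * b)%g; have E2 := sZ b b a.
rewrite (elemC abelG a b) mulgA (elem_sq abelG) mul1g -(elemC abelG a b) in E1.
rewrite (elem_sq abelG) s11 -(elemC abelG a b) in E2.
have s20 c d : s (c, d) + s (c, d) = 0.
  by have /eqP/ffunP/(_ (c, d)) := s2; rewrite mulr2n !ffunE.
have Eab : s ((a * b)%g, (a * b)%g) = s (b, b) + s (1%g, 1%g) - s (b, a)
    + s (a, a) - s (a, b).
  rewrite E2.
  have -> : s ((a * b)%g, (a * b)%g)
    = s (a, b) + s ((a * b)%g, (a * b)%g) - s (a, b) by kunit_abel.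
  by rewrite E1; kunit_abel.
(* Inserting the trivial squares of s(a,b) and s(1,1) corrects the signs of these terms. *)
rewrite !ffunE /= Eab -[LHS]addr0 -(s20 a b) -[LHS]subr0 -(s20 1%g 1%g).
by kunit_abel.
Qed.

(** On [delta f] the squaring map is f(a)^2/f(1)^2, and f^2 = 1 on the kernel of [Phi]. Hence
    squaring descends to X(triv). *)
Lemma squaring_ker s : s \in kerPhi abelG abelG -> squaring s = 0.
Proof.
case/kerPhiP => t [<- /(congr1 val) t0]; have [f tE] := B2N_ex t.
move: t0; rewrite (PhiE abelG tE) mulr2n => /ffunP f2.
apply/ffunP => a; rewrite !ffunE /= tE !ffunE /= !(elem_sq abelG).
have := f2 a; have := f2 1%g; rewrite !ffunE => f1 fa.
by rewrite fa f1 subrr.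
Qed.

Definition Xquad x : {ffun gT -> kunit k} :=
  squaring (generic_quotient.repr x : Z2N k gT).

Lemma Xquad_class s : Xquad (Xclass abelG s) = squaring s.
Proof.
apply/eqP; rewrite -subr_eq0 -squaring_is_additive; apply/eqP.
by apply: (@squaring_ker (_ - s)); rewrite -Xclass_eq Xclass_repr.
Qed.

Lemma XquadD x y : Xquad (x + y) = Xquad x + Xquad y.
Proof.
rewrite -[x]Xclass_repr -[y]Xclass_repr -raddfD !Xquad_class.
set s := generic_quotient.repr x; set t := generic_quotient.repr y.
by apply/ffunP => a; rewrite !ffunE /=; kunit_abel.
Qed.

Lemma Xquad_act x phi : Xquad (Xact x phi) = Defs.act1 (Xquad x) phi.
Proof. by rewrite -[x]Xclass_repr Xact_class !Xquad_class -squaring_act. Qed.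

Lemma XquadM x a b :
  Xquad x (a * b)%g = Xquad x a + Xquad x b + Xproj x (a, b).
Proof. by rewrite -[x]Xclass_repr Xproj_class !Xquad_class squaringM. Qed.

End QuadraticForm.

(** * Transvections and dual vectors of the F_2-space G *)

Section Transvection.
Variable gT : finGroupType.
Hypothesis abelG : (2.-abelem [set: gT])%g.
Implicit Types (l m : gT -> bool) (e : gT).

Definition linear_form l := forall a b, l (a * b)%g = l a (+) l b.

Definition transvection l e (a : gT) : gT := if l a then (a * e)%g else a.

Lemma transvectionM l e : linear_form l -> l e = false ->
  {morph transvection l e : a b / (a * b)%g}.
Proof.
move=> lM le a b; rewrite /transvection lM.
case: (l a); case: (l b) => //=; rewrite -?mulgA //.
  by rewrite (elemC abelG b e) !mulgA -(mulgA a e e) (elem_sq abelG) mulg1.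
by rewrite (elemC abelG e b).
Qed.

Lemma transvectionK l e : linear_form l -> l e = false ->
  involutive (transvection l e).
Proof.
move=> lM le a; rewrite /transvection; case la: (l a); last by rewrite la.
by rewrite lM la le /= -mulgA (elem_sq abelG) mulg1.
Qed.

Lemma transvection_aut l e : linear_form l -> l e = false ->
  exists phi : AutG gT, autV phi =1 transvection l e.
Proof.
move=> lM le; pose p := perm (can_inj (transvectionK lM le)).
have pA : p \in Aut [set: gT].
  rewrite inE; apply/andP; split; first by apply/subsetP => a; rewrite inE.
  by apply/morphicP => a b _ _; rewrite !permE transvectionM.
(* [autV] acts through the inverse automorphism. *)
exists (subg (Aut_group [set: gT]) p^-1)%g => a.
by rewrite /autV subgK ?groupV // invgK permE.
Qed.

(** Rank above 2 provides three coordinates and their basis vectors, under the isomorphism of G with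
    row vectors over F_2. *)
Lemma dual_basis3 : (2 < 'r([set: gT])%g)%N ->
  exists (l : 'I_3 -> gT -> bool) (e : 'I_3 -> gT),
  (forall i, linear_form (l i)) /\ (forall i j, l i (e j) = (i == j)).
Proof.
move=> r3; have ntG : [set: gT] != 1%g.
  by apply: contraTneq r3 => ->; rewrite rank1.
pose n := (abelem_dim' [set: gT]).+1.
have n3 : (2 < n)%N.
  by rewrite /n (dim_abelemE abelG ntG) // -(rank_abelem abelG).
pose l (i : 'I_n) a := abelem_rV abelG ntG a ord0 i != 0.
have lM i : linear_form (l i).
  move=> a b; rewrite /l abelem_rV_M ?inE // mxE.
  move: (abelem_rV abelG ntG a ord0 i) (abelem_rV abelG ntG b ord0 i).
  by do 2!case=> [[|[|?]] ?].
pose e (i : 'I_n) := rVabelem abelG ntG (delta_mx ord0 i).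
have le i j : l i (e j) = (i == j).
  by rewrite /l /e rVabelemK mxE eqxx /=; case: (i == j).
exists (fun i => l (widen_ord n3 i)), (fun i => e (widen_ord n3 i)).
by split=> // i j; rewrite le.
Qed.

End Transvection.

(** * The alternating bicharacters (-1)^(l /\ m) *)

Section WedgeForm.
Variables (k : fieldType) (gT : finGroupType).
Implicit Types (l m : gT -> bool).

Definition kunit_sign (b : bool) : kunit k :=
  KUnit (negbT (signr_eq0 k b)).

Lemma kunit_signD b c : kunit_sign (b (+) c) = kunit_sign b + kunit_sign c.
Proof. by apply: val_inj; rewrite /= signr_addb. Qed.

Lemma kunit_sign0 : kunit_sign false = 0.
Proof. exact: val_inj. Qed.

Lemma kunit_sign_neq0 : [pchar k] =i pred0 -> kunit_sign true != 0.
Proof.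
move=> char0; apply/eqP => /(congr1 (@kval k)) /= /eqP.
by rewrite expr1 eq_sym -addr_eq0 -mulr2n (pcharf0P k).1.
Qed.

Definition wedge_fun l m : {ffun gT * gT -> kunit k} :=
  [ffun ab => kunit_sign ((l ab.1 && m ab.2) (+) (m ab.1 && l ab.2))].

Lemma wedge_alt l m (lM : linear_form l) (mM : linear_form m) :
  wedge_fun l m \in @alt_pred k gT.
Proof.
apply/Defs.altP; split=> [a b c|a b c|a]; rewrite !ffunE /= -?kunit_signD.
- rewrite lM mM; congr kunit_sign.
  by case: (l a); case: (l b); case: (l c); case: (m a); case: (m b); case: (m c).
- rewrite lM mM; congr kunit_sign.
  by case: (l a); case: (l b); case: (l c); case: (m a); case: (m b); case: (m c).
- by rewrite andbC addbb kunit_sign0.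
Qed.

Definition wedge l m (lM : linear_form l) (mM : linear_form m) : altG k gT :=
  AltG (wedge_alt lM mM).

Lemma linear_formD l m : linear_form l -> linear_form m ->
  linear_form (fun a => l a (+) m a).
Proof. by move=> lM mM a b; rewrite lM mM addbACA. Qed.

Lemma wedgeDr l m m' (lM : linear_form l) (mM : linear_form m)
    (mM' : linear_form m') :
  wedge lM (linear_formD mM mM') = wedge lM mM + wedge lM mM'.
Proof.
apply/val_inj/ffunP => -[a b]; rewrite [RHS]ffunE !ffunE /= -kunit_signD.
congr kunit_sign.
by case: (l a); case: (l b); case: (m a); case: (m b); case: (m' a); case: (m' b).
Qed.

(** The transvection fixes m and turns l into l + l(e) m, while m /\ m = 0. *)
Lemma wedge_transvection l m (lM : linear_form l) (mM : linear_form m) e phi :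
  m e = false -> autV phi =1 transvection m e ->
  altG_act (wedge lM mM) phi = wedge lM mM.
Proof.
move=> me phiE; apply/val_inj/ffunP => -[a b]; rewrite !ffunE /= !phiE.
rewrite /transvection; congr kunit_sign.
case ma: (m a); case mb: (m b); rewrite ?lM ?mM ?me ?ma ?mb //=.
  by case: (l a); case: (l b); case: (l e).
by rewrite !andbF.
Qed.

End WedgeForm.

(** * Values forced on an equivariant choice of quadratic forms *)

Section EquivariantQuadraticForms.
Variables (k : fieldType) (gT : finGroupType).
Hypothesis abelG : (2.-abelem [set: gT])%g.
Variable q : altG k gT -> {ffun gT -> kunit k}.
Hypothesis q_act : forall beta phi, q (altG_act beta phi) = Defs.act1 (q beta) phi.
Hypothesis q_polar : forall beta a b,
  q beta (a * b)%g = q beta a + q beta b + beta (a, b).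

Lemma q_wedge_transvection l m (lM : linear_form l) (mM : linear_form m) e a :
  m e = false -> q (wedge k lM mM) (transvection m e a) = q (wedge k lM mM) a.
Proof.
move=> me; have [phi phiE] := transvection_aut abelG mM me.
by rewrite -phiE -[in RHS](wedge_transvection k lM mM me phiE) q_act ffunE.
Qed.

(* The transvection [a |-> a e^(m a)] fixes the form [wedge lM mM] and sends [e']
   to [e' e], so polarization at [(e', e)] determines the value at [e]. *)
Lemma q_wedge l m (lM : linear_form l) (mM : linear_form m) e e' :
  l e -> ~~ m e -> m e' -> q (wedge k lM mM) e = kunit_sign k true.
Proof.
move=> le /negbTE me me'; have := q_wedge_transvection lM mM e' me.
rewrite /transvection me' q_polar -addrA -[RHS]addr0 => /addrI /eqP.
rewrite addr_eq0 => /eqP ->; apply: val_inj.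
by rewrite !ffunE /= le me me' andbF invrN invr1.
Qed.

End EquivariantQuadraticForms.

Theorem theorem7p2 (k : closedFieldType) (gT : finGroupType) (n : nat)
    (char0 : [pchar k]%R =i pred0)
    (abelG : (2.-abelem [set: gT])%g)
    (rankG : 'r([set: gT])%g = n)
    (n_gt2 : (2 < n)%N) :
  ~ splits (Xtriv_ses k abelG).
Proof.
case=> sigma [sigma_act sigmaK]; rewrite -rankG in n_gt2.
have [l [e [lM le]]] := dual_basis3 abelG n_gt2.
pose i0 : 'I_3 := @Ordinal 3 0 isT; pose i1 : 'I_3 := @Ordinal 3 1 isT.
pose i2 : 'I_3 := @Ordinal 3 2 isT.
(* The section picks for each [beta] a quadratic form with polarization [beta]. *)
pose q (beta : altG k gT) := @Xquad k gT abelG (sigma beta).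
have q_act beta phi : q (altG_act beta phi) = Defs.act1 (q beta) phi.
  by rewrite /q -Xquad_act; congr Xquad; apply: sigma_act.
have q_polar (beta : altG k gT) a b :
    q beta (a * b)%g = q beta a + q beta b + beta (a, b).
  by rewrite /q XquadM; congr (_ + altG_val _ _); apply: sigmaK.
have qD beta gamma : q (beta + gamma) = q beta + q gamma.
  by rewrite /q -XquadD; congr Xquad; apply: (raddfD sigma).
have q1 : q (wedge k (lM i0) (lM i1)) (e i0) = kunit_sign k true.
  by apply: (q_wedge abelG q_act q_polar _ _ (e' := e i1)); rewrite le.
have q2 : q (wedge k (lM i0) (lM i2)) (e i0) = kunit_sign k true.
  by apply: (q_wedge abelG q_act q_polar _ _ (e' := e i2)); rewrite le.
have : q (wedge k (lM i0) (linear_formD (lM i1) (lM i2))) (e i0)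
       = kunit_sign k true.
  (* The sum of the last two coordinates is 0 at [e i0] and 1 at [e i1]. *)
  by apply: (q_wedge abelG q_act q_polar _ _ (e' := e i1)); rewrite !le.
(* By additivity the same value is (-1)(-1) = 1, contradicting characteristic 0. *)
rewrite wedgeDr qD ffunE q1 q2 -kunit_signD kunit_sign0.
by move/esym/eqP; apply/negP/kunit_sign_neq0.
Qed.
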